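(* Let $\mathbf{V}$ be a variety of algebras of type $\mathcal{L}$, let $n$ be a positive integer, let $A\in\mathbf{V}$, and let $E\subseteq A^n$ be an algebraic set. Then $\mathrm{Rad}(E)$ is a fully characteristic congruence of $F_{\mathbf{V}}(n)$ if and only if $E=\bigcup_i K_i^n$ for some family $\{K_i\}$ of $n$-generator subalgebras of $A$.
   Context: $\mathcal{L}$ is an algebraic (purely functional) language. $X=\{x_1,\dots,x_n\}$ is a finite set of variables and $F_{\mathbf{V}}(n)$ is the relatively free algebra of $\mathbf{V}$ generated by $X$. For $p\in F_{\mathbf{V}}(n)$, $A\in\mathbf{V}$ and $\overline{a}=(a_1,\dots,a_n)\in A^n$, $p(\overline{a})\in A$ is the image of $p$ under the unique homomorphism $F_{\mathbf{V}}(n)\to A$ with $x_i\mapsto a_i$. An equation is a pair $(p,q)$, also written $p\approx q$, of elements of $F_{\mathbf{V}}(n)$ (terms in $x_1,\dots,x_n$). For a system (set) of equations $S$, $V_A(S)=\{\overline{a}\in A^n : p(\overline{a})=q(\overline{a}) \text{ for all } (p,q)\in S\}$. A set $E\subseteq A^n$ is algebraic if $E=V_A(S)$ for some system $S$. For $E\subseteq A^n$, $\mathrm{Rad}(E)=\{(p,q)\in F_{\mathbf{V}}(n)^2 : p(\overline{a})=q(\overline{a})\text{ for all }\overline{a}\in E\}$, a congruence of $F_{\mathbf{V}}(n)$. A congruence $R$ of $F_{\mathbf{V}}(n)$ is fully characteristic (fully invariant) if $(\alpha(p),\alpha(q))\in R$ for every endomorphism $\alpha$ of $F_{\mathbf{V}}(n)$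 and every $(p,q)\in R$. An $n$-generator subalgebra is one generated by some $n$ (not necessarily distinct) elements. Families may be empty. *)

(* Defs.v *)
From HB Require Import structures.
From mathcomp Require Import all_boot.
From mathcomp Require Import all_classical.

Set Implicit Arguments.
Unset Strict Implicit.
Unset Printing Implicit Defensive.

Local Open Scope classical_set_scope.
Local Open Scope quotient_scope.

(** Universal algebra over a purely functional language, inside classical
    MathComp.  [A^n] is rendered as ['I_n -> A]. *)

Record language := Language {
  op : Type;
  arity : op -> nat }.

(* Constants are operations of arity 0.  The carrier may be empty when the
   language has no constants. *)
Record algebra (L : language) := Algebra {
  carrier :> Type;
  interp : forall o : op L, ('I_(arity o) -> carrier) -> carrier }.
Arguments interp {L} _ o _.

Inductive term (L : language) (X : Type) : Type :=
| Var of X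
| App (o : op L) of ('I_(arity o) -> term L X).
Arguments Var {L X} _.
Arguments App {L X} o _.

HB.instance Definition _ (L : language) (X : Type) := gen_eqMixin (term L X).
HB.instance Definition _ (L : language) (X : Type) :=
  gen_choiceMixin (term L X).

Fixpoint eval (L : language) (X : Type) (A : algebra L) (a : X -> A)
    (t : term L X) : A :=
  match t with
  | Var x => a x
  | App o ts => interp A o (fun j => eval a (ts j))
  end.

Fixpoint subst (L : language) (X Y : Type) (b : X -> term L Y)
    (t : term L X) : term L Y :=
  match t with
  | Var x => b x
  | App o ts => App o (fun j => subst b (ts j))
  end.

Lemma eval_subst (L : language) (X Y : Type) (A : algebra L) (a : Y -> A)
    (b : X -> term L Y) (t : term L X) :
  eval a (subst b t) = eval (fun x => eval a (b x)) t.
Proof.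
by elim: t => [x|o ts IH] //=; congr (interp A o _); apply/funext.
Qed.

Definition is_hom (L : language) (A B : algebra L) (f : A -> B) : Prop :=
  forall (o : op L) (u : 'I_(arity o) -> A),
    f (interp A o u) = interp B o (fun j => f (u j)).

Definition satisfies (L : language) (X : Type) (A : algebra L)
    (s t : term L X) : Prop :=
  forall a : X -> A, eval a s = eval a t.

(* A variety is an equational class; the identities use countably many
   variables, so that none of them is lost. *)
Definition is_variety (L : language) (V : algebra L -> Prop) : Prop :=
  exists Sigma : set (term L nat * term L nat),
    forall A : algebra L, V A <-> forall e, Sigma e -> satisfies A e.1 e.2.

(** The relatively free algebra: terms in [n] variables modulo the identities
    valid in all members of [V]. *)

Section FreeAlgebra.
Variables (L : language) (V : algebra L -> Prop) (n : nat).

Definition identity (s t : term L 'I_n) : Prop :=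
  forall A : algebra L, V A -> satisfies A s t.

Definition identityb (s t : term L 'I_n) : bool := `[< identity s t >].

Lemma identityb_refl : reflexive identityb.
Proof. by move=> s; apply/asboolP. Qed.

Lemma identityb_sym : symmetric identityb.
Proof.
by move=> s t; apply/asboolP/asboolP => st A VA a; rewrite (st A VA a).
Qed.

Lemma identityb_trans : transitive identityb.
Proof.
move=> t s u /asboolP st /asboolP tu; apply/asboolP => A VA a.
by rewrite (st A VA a) (tu A VA a).
Qed.

Canonical identity_equiv :=
  EquivRel identityb identityb_refl identityb_sym identityb_trans.

Definition free_carrier : Type := {eq_quot identity_equiv}.

Definition free_class (t : term L 'I_n) : free_carrier :=
  \pi_{eq_quot identity_equiv} t.

Definition free_repr (p : free_carrier) : term L 'I_n :=
  @repr _ {eq_quot identity_equiv} p.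

Definition free : algebra L :=
  @Algebra L free_carrier
    (fun o u => free_class (App o (fun j => free_repr (u j)))).

Definition free_gen (i : 'I_n) : free := free_class (Var i).

(* [feval p a] is p(a), for [A] in [V]: by [feval_hom], [feval_gen] and
   [feval_unique], [fun p => feval p a] is then the unique homomorphism
   [free -> A] sending each generator [free_gen i] to [a i]. *)
Definition feval (A : algebra L) (p : free) (a : 'I_n -> A) : A :=
  eval a (free_repr p).

Lemma free_classP (s t : term L 'I_n) :
  free_class s = free_class t <-> identity s t.
Proof.
split=> [st|st]; first by have /eqmodP/asboolP := st.
by apply/eqmodP/asboolP.
Qed.

Lemma free_reprK (p : free) : free_class (free_repr p) = p.
Proof. exact: (@reprK _ {eq_quot identity_equiv}). Qed.

Lemma feval_class (A : algebra L) (t : term L 'I_n) (a : 'I_n -> A) :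
  V A -> feval (free_class t) a = eval a t.
Proof.
move=> VA.
by have /free_classP/(_ A VA a) := free_reprK (free_class t).
Qed.

Lemma free_interp (o : op L) (ts : 'I_(arity o) -> term L 'I_n) :
  interp free o (fun j => free_class (ts j)) = free_class (App o ts).
Proof.
apply/free_classP => A VA a /=; congr (interp _ o _); apply/funext => j.
exact: feval_class.
Qed.

Lemma feval_hom (A : algebra L) (a : 'I_n -> A) :
  V A -> is_hom (fun p : free => feval p a).
Proof. by move=> VA o u; rewrite feval_class. Qed.

Lemma feval_gen (A : algebra L) (a : 'I_n -> A) (i : 'I_n) :
  V A -> feval (free_gen i) a = a i.
Proof. exact: feval_class. Qed.

Lemma feval_unique (A : algebra L) (a : 'I_n -> A) (f : free -> A) :
  V A -> is_hom f -> (forall i, f (free_gen i) = a i) ->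
  forall p, f p = feval p a.
Proof.
move=> VA fh fg p; rewrite -[p in LHS]free_reprK /feval.
elim: (free_repr p) => [i|o ts IH] /=; first exact: fg.
by rewrite -free_interp fh; congr (interp _ o _); apply/funext.
Qed.

Lemma eval_free (X : Type) (b : X -> term L 'I_n) (t : term L X) :
  eval (A := free) (fun x => free_class (b x)) t = free_class (subst b t).
Proof.
elim: t => [x|o ts IH] //=.
rewrite -[RHS]free_interp -[LHS]/(interp free o _).
by congr (interp free o _); apply/funext.
Qed.

Lemma free_in_variety : is_variety V -> V free.
Proof.
move=> [Sigma VE]; apply/VE => e Se b.
have -> : b = (fun x => free_class (free_repr (b x)) : free).
  by apply/funext => x; rewrite free_reprK.
rewrite !eval_free; apply/free_classP => A VA a.
rewrite !eval_subst.
by have /VE/(_ e Se) := VA; apply.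
Qed.

End FreeAlgebra.

Definition is_congruence (L : language) (B : algebra L) (R : set (B * B)) :
    Prop :=
  [/\ forall p, R (p, p),
      forall p q, R (p, q) -> R (q, p),
      forall p q r, R (p, q) -> R (q, r) -> R (p, r)
    & forall (o : op L) (u v : 'I_(arity o) -> B),
        (forall j, R (u j, v j)) -> R (interp B o u, interp B o v)].

Definition fully_characteristic (L : language) (B : algebra L)
    (R : set (B * B)) : Prop :=
  forall alpha : B -> B, is_hom alpha ->
    forall p q, R (p, q) -> R (alpha p, alpha q).

Section AlgebraicSets.
Variables (L : language) (V : algebra L -> Prop) (n : nat) (A : algebra L).

Definition solutions (S : set (free V n * free V n)) : set ('I_n -> A) :=
  [set a | forall p q, S (p, q) -> feval p a = feval q a].

Definition algebraic (E : set ('I_n -> A)) : Prop :=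
  exists S : set (free V n * free V n), E = solutions S.

Definition Rad (E : set ('I_n -> A)) : set (free V n * free V n) :=
  [set e | forall a, E a -> feval e.1 a = feval e.2 a].

End AlgebraicSets.
Arguments algebraic {L} V {n A} E.
Arguments Rad {L} V {n A} E.

Definition is_subalgebra (L : language) (A : algebra L) (K : set A) : Prop :=
  forall (o : op L) (u : 'I_(arity o) -> A),
    (forall j, K (u j)) -> K (interp A o u).

Definition generated (L : language) (A : algebra L) (G : set A) : set A :=
  smallest (@is_subalgebra L A) G.

Definition n_generator (L : language) (A : algebra L) (n : nat) (K : set A) :
    Prop :=
  exists g : 'I_n -> A, K = generated (range g).

Definition set_power (T : Type) (n : nat) (K : set T) : set ('I_n -> T) :=
  [set a | forall i, K (a i)].

Arguments set_power {T} n K _.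

(* Main.v *)
(** The subalgebra generated by a tuple [a] is the set of values [p(a)], and an
    endomorphism [alpha] acts on evaluations by [(alpha p)(a) = p(b)] with
    [b_i = (alpha x_i)(a)].  So full characteristicity of [Rad E] says that,
    with [a], every tuple over the subalgebra generated by [a] satisfies
    [Rad E]; as [E] is algebraic, such a tuple lies in [E]. *)

Require Import Defs.
From mathcomp Require Import all_boot.
From mathcomp Require Import all_classical.

Set Implicit Arguments.
Unset Strict Implicit.
Unset Printing Implicit Defensive.

Local Open Scope classical_set_scope.

Lemma generated_subalgebra (L : language) (A : algebra L) (G : set A) :
  is_subalgebra (generated G).
Proof.
by move=> o u Gu K KG; apply: KG.1 => j; exact: Gu.
Qed.

Lemma subalgebra_eval (L : language) (X : Type) (A : algebra L) (K : set A)
    (a : X -> A) (t : term L X) :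
  is_subalgebra K -> (forall x, K (a x)) -> K (eval a t).
Proof. by move=> Ksub Ka; elim: t => [x|o ts IH] //=; apply: Ksub. Qed.

Section FreeEvaluation.
Variables (L : language) (V : algebra L -> Prop) (n : nat) (A : algebra L).
Hypothesis VA : V A.

(** Evaluation at [a] is a homomorphism, so its image is a subalgebra containing each [a i];
    conversely, term values cannot leave a subalgebra containing [a]. *)
Lemma generated_feval (a : 'I_n -> A) :
  generated (range a) = range (fun p : free V n => feval p a).
Proof.
rewrite eqEsubset; split=> [x Gx|_ [p _ <-]].
  apply: Gx; split=> [o u Ku|_ [i _ <-]]; last first.
    by exists (free_gen V i) => //; exact: feval_gen.
  have {}Ku j : exists p : free V n, feval p a = u j.
    by have [p _ pu] := Ku j; exists p.
  (* Applying [o] to chosen preimages of the arguments gives a preimage of the result. *)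
  have [w wu] := choice Ku; exists (interp (free V n) o w) => //.
  by rewrite (feval_hom (V := V) a VA); congr interp; apply/funext.
apply: (subalgebra_eval (free_repr p)); first exact: generated_subalgebra.
by move=> i K [_ aK]; apply: aK; exists i.
Qed.

(** Both sides are homomorphisms in [p] that agree on the generators. *)
Lemma feval_endo (alpha : free V n -> free V n) (a : 'I_n -> A) :
  is_hom alpha ->
  forall p, feval (alpha p) a =
            feval p (fun i => feval (alpha (free_gen V i)) a).
Proof.
move=> alphah; apply: (feval_unique (f := fun p => feval (alpha p) a) VA) => [o u|//].
by rewrite alphah (feval_hom (V := V) a VA).
Qed.

Lemma Rad_congruence (E : set ('I_n -> A)) : is_congruence (Rad V E).
Proof.
split=> [p a //|p q pq a Ea|p q r pq qr a Ea|o u v uv a Ea] /=.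
- by rewrite (pq a Ea).
- by rewrite (pq a Ea) (qr a Ea).
- rewrite !(feval_hom (V := V) a VA); congr interp.
  by apply/funext => j; exact: uv.
Qed.

(** A system defining [E] is contained in [Rad V E], so imposing all of [Rad V E] yields no point
    outside [E]. *)
Lemma algebraic_Rad (E : set ('I_n -> A)) :
  algebraic V E -> solutions (Rad V E) = E.
Proof.
move=> [S ->]; rewrite eqEsubset; split=> a Sa p q Spq.
  by apply: Sa => b; apply.
exact: Spq Sa.
Qed.

End FreeEvaluation.

Theorem theorem1 (L : language) (V : algebra L -> Prop) (hV : is_variety V)
    (n : nat) (hn : (0 < n)%N) (A : algebra L) (hA : V A)
    (E : set ('I_n -> A)) (hE : algebraic V E) :
  (is_congruence (Rad V E) /\ fully_characteristic (Rad V E)) <->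
  exists (I : Type) (K : I -> set A),
    (forall i, n_generator n (K i)) /\
    E = \bigcup_(i in [set: I]) set_power n (K i).
Proof.
split=> [[_ Rfc]|[I [K [Kgen EK]]]]; last first.
  split; first exact: Rad_congruence.
  move=> alpha alphah p q pq a; rewrite {1}EK => -[i _ Ka] /=.
  rewrite !(feval_endo hA _ alphah); apply: pq.
  (* The tuple of the [feval (alpha (free_gen V j)) a] stays in the same power of [K i], a
     subalgebra. *)
  rewrite EK; exists i => // j.
  apply: subalgebra_eval => //.
  by have [g ->] := Kgen i; exact: generated_subalgebra.
(* The family is indexed by the points of [E], each giving the subalgebra generated by its
   coordinates. *)
exists {a | E a}, (fun a => generated (range (sval a))); split.
  by move=> a; exists (sval a).
rewrite eqEsubset; split=> [a Ea|b [[a Ea] _ /= Kb]].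
  by exists (exist _ a Ea) => // i K [_ aK]; apply: aK; exists i.
have {}Kb i : exists p : free V n, feval p a = b i.
  by have := Kb i; rewrite (generated_feval hA) => -[p _ pb]; exists p.
have [c cb] := choice Kb.
(* As the free algebra lies in [V], it can be the target of its own universal property: sending the
   generators to [c] extends to an endomorphism. *)
have Vfree := free_in_variety n hV.
pose alpha (p : free V n) := feval p c.
have alphah : is_hom alpha by exact: feval_hom.
have alphab p : feval (alpha p) a = feval p b.
  rewrite (feval_endo hA _ alphah); congr feval; apply/funext => i.
  by rewrite /alpha feval_gen.
(* Testing [b] against [Rad V E] amounts to testing the images under [alpha] at [a]. *)
rewrite -(algebraic_Rad hE) => p q pq; rewrite -!alphab.
exact: (Rfc _ alphah _ _ pq a Ea).
Qed.
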